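(* Let $d,e,r$ be positive integers such that $e$ divides $r$, and let $\mathfrak g\in G(de,1,r)$ be an element of order $e$ such that $G(de,1,r)=G(de,e,r)\rtimes\langle\mathfrak g\rangle$ and $\varepsilon(\mathfrak g)=\zeta^d$. For a divisor $q$ of $e$, $\underline\eta\in\mathcal P_{r,de,q}$ and $0\le j\le q-1$, write $g_{\underline\eta,j}=\mathfrak g^{j}g_{\underline\eta}\mathfrak g^{-j}$. Then the set $$\bigsqcup_{q\mid e}\{g_{\underline\eta,j}\mid \underline\eta\in\mathcal P_{r,de,q},\ 0\le j\le q-1\}$$ is a system of representatives for the conjugacy classes of $G(de,e,r)$.
   Context: $\mathcal U_n$ is the group of complex $n$th roots of unity and $\zeta$ is a fixed generator of $\mathcal U_{de}$. $G(de,1,r)=\mathcal U_{de}^r\rtimes\mathfrak S_r$, with elements $(z;\sigma)$ and $\sigma^{-1}(z_1,\ldots,z_r)\sigma=(z_{\sigma(1)},\ldots,z_{\sigma(r)})$. $\varepsilon(z;\sigma)=(z_1\cdots z_r)^d$ is a linear character of order $e$, and $G(de,e,r)=\ker\varepsilon$. $\mathcal{MP}_{r,de}$ is the set of $de$-multipartitions $\underline\eta=(\eta_0,\ldots,\eta_{de-1})$ of $r$. For a divisor $q$ of $e$, $\mathcal P_{r,de,q}$ is the set of $\underline\eta\in\mathcal{MP}_{r,de}$ of the form $(\eta_0,\emptyset,\ldots,\emptyset,\eta_q,\emptyset,\ldots,\emptyset,\eta_{2q},\emptyset,\ldots,\emptyset,\eta_{de-q},\emptyset,\ldots,\emptyset)$,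 that is, with $\eta_u=\emptyset$ whenever $q\nmid u$, and such that all parts of every $\eta_u$ are divisible by $q$. For $g=(z;\sigma)$ with $\sigma=\sigma_1\cdots\sigma_s$ a product of disjoint cycles (fixed points included), the cycle product of the $j$th cycle is the product of the $z_k$ with $k$ in the support of $\sigma_j$; the cyclic structure of $g$ is the multipartition in which each $\sigma_j$ contributes a part equal to its length to $\eta_u$, where $\zeta^u$ is its cycle product. It determines the conjugacy class of $g$ in $G(de,1,r)$. The standard representative $g_{\underline\eta}=(z;\sigma)$ is the element of cyclic structure $\underline\eta$ such that $\sigma_j=(L_j+1\ \cdots\ L_j+\ell_j)$ with $L_1=0$, $L_j=\ell_1+\cdots+\ell_{j-1}$ ($\ell_j$ the length of $\sigma_j$), $z_{L_j+1}$ is the cycle product of the $j$th cycle, and $z_k=1$ for all other $k$.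
   Formalization: The set is intersected with G(de,e,r), as some g_{η,j} lie outside it (d=1, e=r=2, η=(∅,(2))); the pieces overlap for q | q', so the disjoint union is read as a plain union, with the claim that g_{η,j}=g_{η',j'} only if η=η' and j=j'. *)

(* Defs.v *)
From HB Require Import structures.
From mathcomp Require Import all_boot all_order all_algebra.
From mathcomp Require Import all_fingroup all_solvable all_field.

Set Implicit Arguments.
Unset Strict Implicit.
Unset Printing Implicit Defensive.

Import GRing.Theory.

(* [mu n] is the group of complex n-th roots of unity, for n > 0; it is meant
   to be used for n > 0 only, where n.-1.+1 = n.  The detour makes [mu n]
   finite for every n; all roots of unity lie in algC. *)
Definition is_mu (n : nat) : pred algC := fun x => (x ^+ n.-1.+1 == 1)%R.

Record mu (n : nat) := Mu { mu_val :> algC; mu_valP : is_mu n mu_val }.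

HB.instance Definition _ n := [isSub for @mu_val n].
HB.instance Definition _ n := [Choice of mu n by <:].

Lemma is_muE n x : 0 < n -> is_mu n x = (x ^+ n == 1)%R.
Proof. by move=> n_gt0; rewrite /is_mu prednK. Qed.

Section MuFinite.

Variable n : nat.

Let root := sval (C_prim_root_exists (ltn0Sn n.-1)).
Let prim_root : (n.-1.+1.-primitive_root root)%R :=
  svalP (C_prim_root_exists (ltn0Sn n.-1)).

Fact mu_one_subproof : is_mu n 1%R. Proof. exact/eqP/expr1n. Qed.

Lemma mu_log (x : mu n) : exists i : 'I_n.-1.+1, val x == (root ^+ i)%R.
Proof.
have xn1 : (val x ^+ n.-1.+1 = 1)%R by apply/eqP; exact: (valP x).
by have [i ->] := prim_rootP prim_root xn1; exists i.
Qed.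

Lemma mu_logK :
  cancel (fun x => xchoose (mu_log x))
         (fun i => insubd (Mu mu_one_subproof)
                          (root ^+ i)%R).
Proof.
move=> x; apply: val_inj; rewrite -(eqP (xchooseP (mu_log x))).
by rewrite val_insubd (valP x).
Qed.

HB.instance Definition _ := [Countable of mu n by <:].
HB.instance Definition _ : isFinite (mu n) := CanIsFinite mu_logK.

Definition mu_one : mu n := Mu mu_one_subproof.

Fact mu_mul_subproof (x y : mu n) : is_mu n (val x * val y)%R.
Proof.
by rewrite /is_mu exprMn (eqP (valP x)) (eqP (valP y)) mul1r.
Qed.
Definition mu_mul (x y : mu n) : mu n := Mu (mu_mul_subproof x y).

Fact mu_inv_subproof (x : mu n) : is_mu n (val x)^-1%R.
Proof. by rewrite /is_mu exprVn (eqP (valP x)) invr1. Qed.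
Definition mu_inv (x : mu n) : mu n := Mu (mu_inv_subproof x).

Fact mu_mulA : associative mu_mul.
Proof. by move=> x y z; apply: val_inj; rewrite /= mulrA. Qed.
Fact mu_mul1 : left_id mu_one mu_mul.
Proof. by move=> x; apply: val_inj; rewrite /= mul1r. Qed.
Fact mu_mulV : left_inverse mu_one mu_inv mu_mul.
Proof.
move=> x; apply: val_inj; rewrite /= mulVf //.
by apply/eqP=> x0; have := valP x; rewrite /= /is_mu x0 expr0n eq_sym oner_eq0.
Qed.

HB.instance Definition _ :=
  Finite_isGroup.Build (mu n) mu_mulA mu_mul1 mu_mulV.

End MuFinite.

Lemma val_muM n (x y : mu n) : val (x * y)%g = (val x * val y)%R.
Proof. by []. Qed.

Lemma val_mu1 n : val (1%g : mu n) = 1%R.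
Proof. by []. Qed.

Lemma val_muX n (x : mu n) k : val (x ^+ k)%g = (val x ^+ k)%R.
Proof. by elim: k => // k IHk; rewrite expgS exprS val_muM IHk. Qed.

(* G(n,1,r), the semidirect product of (mu n)^r by S_r; [MkGn1 z s] stands
   for (z; s).  The conjugation rule
     s^-1 (z_1, ..., z_r) s = (z_{s(1)}, ..., z_{s(r)})
   makes conjugation a right action only if products in S_r compose from right
   to left, (s t)(i) = s (t i).  MathComp's product on 'S_r composes in the
   other order, hence [sigma_of h * sigma_of g] below. *)
Record Gn1 (n r : nat) :=
  MkGn1 { z_of : {ffun 'I_r -> mu n}; sigma_of : 'S_r }.

Definition Gn1_pair n r (g : Gn1 n r) := (z_of g, sigma_of g).

Lemma Gn1_pairK n r : cancel (@Gn1_pair n r) (fun p => MkGn1 p.1 p.2).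
Proof. by case. Qed.

HB.instance Definition _ n r :=
  Finite.copy (Gn1 n r) (can_type (@Gn1_pairK n r)).

Section Wreath.

Variables n r : nat.
Implicit Types g h : Gn1 n r.

Definition Gn1_mul g h : Gn1 n r :=
  MkGn1 [ffun k => z_of g k * z_of h ((sigma_of g)^-1 k)]%g
        (sigma_of h * sigma_of g)%g.
Definition Gn1_one : Gn1 n r := MkGn1 [ffun => 1%g] 1%g.
Definition Gn1_inv g : Gn1 n r :=
  MkGn1 [ffun k => (z_of g (sigma_of g k))^-1]%g (sigma_of g)^-1%g.

Fact Gn1_mulA : associative Gn1_mul.
Proof.
move=> x y z; congr MkGn1; last by rewrite /= mulgA.
by apply/ffunP=> k; rewrite !ffunE /= mulgA invMg permM.
Qed.
Fact Gn1_mul1 : left_id Gn1_one Gn1_mul.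
Proof.
move=> [z s]; congr MkGn1; last by rewrite /= mulg1.
by apply/ffunP=> k; rewrite !ffunE /= mul1g invg1 perm1.
Qed.
Fact Gn1_mulV : left_inverse Gn1_one Gn1_inv Gn1_mul.
Proof.
move=> [z s]; congr MkGn1; last by rewrite /= mulgV.
by apply/ffunP=> k; rewrite !ffunE /= invgK mulVg.
Qed.

HB.instance Definition _ :=
  Finite_isGroup.Build (Gn1 n r) Gn1_mulA Gn1_mul1 Gn1_mulV.

(* The conjugation rule s^-1 z s = (z_{s(1)}, ..., z_{s(r)}). *)
Lemma Gn1_conj_perm (z : {ffun 'I_r -> mu n}) (s : 'S_r) :
  ((MkGn1 [ffun => 1%g] s)^-1 * MkGn1 z 1%g * MkGn1 [ffun => 1%g] s)%g
  = MkGn1 [ffun k => z (s k)] 1%g.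
Proof.
congr MkGn1; last by rewrite /= mul1g mulgV.
by apply/ffunP=> k; rewrite !ffunE /= invgK invg1 mul1g mulg1.
Qed.

End Wreath.

Section Epsilon.

Variables (d e r : nat).

Definition eps (g : Gn1 (d * e) r) : algC :=
  ((\prod_(k < r) val (z_of g k)) ^+ d)%R.

Lemma epsM g h : eps (g * h)%g = (eps g * eps h)%R.
Proof.
rewrite /eps -exprMn; congr (_ ^+ _)%R.
rewrite [X in (_ * X)%R](reindex_inj (@perm_inj _ (sigma_of g)^-1%g)).
rewrite -big_split /=.
by apply: eq_bigr => k _; rewrite ffunE.
Qed.

Definition Gder : {set Gn1 (d * e) r} := [set g | (eps g == 1)%R].

Fact Gder_group_set : group_set Gder.
Proof.
apply/group_setP; split=> [|g h].
  by rewrite inE /eps big1 ?expr1n // => k _; rewrite ffunE.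
by rewrite !inE epsM => /eqP-> /eqP->; rewrite mul1r.
Qed.
Canonical Gder_group := Group Gder_group_set.

End Epsilon.

(* n-multipartitions of r.  A partition occurring in a multipartition of r has
   at most r parts, each at most r, so that nothing is lost by encoding it as a
   bounded sequence over 'I_r.+1; [parts] reads it as a sequence of naturals. *)
Definition mseq (n r : nat) := {ffun 'I_n -> r.-bseq 'I_r.+1}.

Definition parts n r (eta : mseq n r) (u : 'I_n) : seq nat :=
  [seq val p | p <- eta u].

Definition is_partition (s : seq nat) := sorted geq s && (0 \notin s).

Definition MP (n r : nat) : {set mseq n r} :=
  [set eta | [forall u, is_partition (parts eta u)]
             && (\sum_(u < n) sumn (parts eta u) == r)].

Definition MPdiv (n r q : nat) : {set mseq n r} :=
  [set eta in MP n r
     | [forall u : 'I_n, (q %| u) || (parts eta u == [::])]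
       && [forall u : 'I_n, all (dvdn q) (parts eta u)]].

Section CyclicStructure.

Variables (n r : nat) (zeta : mu n).

Definition cycle_prod (g : Gn1 n r) (c : {set 'I_r}) : algC :=
  (\prod_(k in c) val (z_of g k))%R.

Definition has_cyclic_structure (g : Gn1 n r) (eta : mseq n r) :=
  forall u : 'I_n,
    parts eta u =
    sort geq [seq #|c| | c : {set 'I_r} <- enum (porbits (sigma_of g))
                                      & cycle_prod g c == (val zeta ^+ u)%R].

(* [ls] is the sequence (l_1, ..., l_s) of cycle lengths and [sumn (take j ls)]
   is L_{j+1}; coordinates start at 0 here.  The order in which the cycles are
   numbered is left free. *)
Definition is_standard_rep (eta : mseq n r) (g : Gn1 n r) :=
  has_cyclic_structure g eta /\
  exists ls : seq nat,
    [/\ 0 \notin ls, sumn ls = r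
      & forall (j : nat) (k : 'I_r),
          let L := sumn (take j ls) in let l := nth 0 ls j in
          j < size ls -> L <= k < L + l ->
            sigma_of g k = (if k.+1 < L + l then k.+1 else L) :> nat
            /\ val (z_of g k)
               = (if k == L :> nat
                  then cycle_prod g (porbit (sigma_of g) k) else 1%R)].

End CyclicStructure.

Section StandardRepExists.

Variables (n r : nat) (zeta : mu n) (eta : mseq n r) (u0 : 'I_n).
Hypothesis zeta_gen : generator [set: mu n] zeta.
Hypothesis etaMP : eta \in MP n r.

Let cyc : seq (nat * 'I_n) :=
  flatten [seq [seq (p, u) | p <- parts eta u] | u <- enum 'I_n].
Let ls := [seq x.1 | x <- cyc].
Let us j : 'I_n := (nth (0, u0) cyc j).2.

Let ls_parts : ls = flatten [seq parts eta u | u <- enum 'I_n].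
Proof.
rewrite /ls map_flatten -map_comp; congr flatten; apply: eq_map => u /=.
by rewrite -map_comp map_id.
Qed.

Let parts_cyc u : [seq x.1 | x <- cyc & x.2 == u] = parts eta u.
Proof.
rewrite filter_flatten map_flatten -2!map_comp.
rewrite (eq_map (_ : _ =1 fun v => if v == u then parts eta u else [::])).
  have: uniq (enum 'I_n) by apply: enum_uniq.
  have: u \in enum 'I_n by apply: mem_enum.
  elim: (enum 'I_n) => //= v s IHs; rewrite inE => /predU1P[<-|us'].
    case/andP=> nus _; rewrite eqxx [flatten _](_ : _ = [::]) ?cats0 //.
    elim: s {IHs} nus => //= w s IHs; rewrite inE negb_or eq_sym.
    by case/andP=> /negbTE-> /IHs.
  case/andP=> nvs /(IHs us') ->; case: eqP => // vu.
  by rewrite vu us' in nvs.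
move=> v /=; rewrite filter_map -map_comp.
have [->|vu] := eqVneq.
  by rewrite (eq_filter (a2 := predT)) ?filter_predT ?map_id // => p /=; apply: eqxx.
by rewrite (eq_filter (a2 := pred0)) ?filter_pred0 // => p /=; apply: negbTE.
Qed.

Let ls_gt0 j : j < size ls -> 0 < nth 0 ls j.
Proof.
move=> j_lt; rewrite lt0n; apply/eqP=> l0.
have: 0 \in ls by rewrite -l0 mem_nth.
rewrite ls_parts => /flattenP[s /mapP[u _ ->]].
have: eta \in MP n r by [].
by rewrite inE => /andP[/forallP/(_ u)/andP[_ /negbTE->]].
Qed.

Let sumn_ls : sumn ls = r.
Proof.
rewrite ls_parts sumn_flatten sumnE big_map big_map big_enum /=.
by move: etaMP; rewrite inE => /andP[_ /eqP].
Qed.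

Let ltls (k : 'I_r) : k < sumn ls. Proof. by rewrite sumn_ls. Qed.

Let b (k : 'I_r) := reshape_index ls k.
Let o (k : 'I_r) := reshape_offset ls k.
Let l k := nth 0 ls (b k).

Let b_lt k : b k < size ls. Proof. exact/reshape_indexP/ltls. Qed.
Let o_lt k : o k < l k. Proof. exact/reshape_offsetP/ltls. Qed.
Let l_gt0 k : 0 < l k. Proof. exact/ls_gt0/b_lt. Qed.
Let mod_lt k m : m %% l k < l k. Proof. by rewrite ltn_mod. Qed.

Let rot_lt k : flatten_index ls (b k) ((o k).+1 %% l k) < r.
Proof. by rewrite -{1}sumn_ls; apply/flatten_indexP/mod_lt. Qed.

Let rotf k : 'I_r := Ordinal (rot_lt k).

Let b_rot k : b (rotf k) = b k. Proof. exact/flatten_indexKl/mod_lt. Qed.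
Let o_rot k : o (rotf k) = (o k).+1 %% l k.
Proof. exact/flatten_indexKr/mod_lt. Qed.

Let bo_inj k k' : b k = b k' -> o k = o k' -> k = k'.
Proof.
move=> bE oE; apply: val_inj; rewrite -[LHS](reshape_indexK ls).
by rewrite -[RHS](reshape_indexK ls) -/(b k) -/(o k) bE oE.
Qed.

Let rotf_inj : injective rotf.
Proof.
move=> k k' eq_k; have := congr1 b eq_k; rewrite !b_rot => bE.
apply: bo_inj => //; have := congr1 o eq_k; rewrite !o_rot.
have lE : l k' = l k by rewrite /l bE.
move/eqP; rewrite lE -[(o k).+1]addn1 -[(o k').+1]addn1 eqn_modDr !modn_small ?o_lt // => [/eqP //|].
by rewrite -lE.
Qed.

Let sg : 'S_r := perm rotf_inj.
Let zz : {ffun 'I_r -> mu n} :=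
  [ffun k => if o k == 0 then (zeta ^+ us (b k))%g else 1%g].
Let g := MkGn1 zz sg.

Let sgX m k : b ((sg ^+ m)%g k) = b k /\ o ((sg ^+ m)%g k) = (o k + m) %% l k.
Proof.
elim: m => [|m [IHb IHo]].
  by rewrite perm1 addn0 modn_small.
rewrite expgSr permM permE b_rot o_rot /l IHb IHo -/(l k); split=> //.
by rewrite -addn1 modnDml addn1 addnS.
Qed.

Let block j : {set 'I_r} := [set k | b k == j].

Let porbit_sg k : porbit sg k = block (b k).
Proof.
apply/setP=> k'; rewrite inE; apply/porbitP/eqP => [[m ->]|bE].
  by case: (sgX m k).
exists (o k' + (l k - o k)); have [Hb Ho] := sgX (o k' + (l k - o k)) k.
apply: bo_inj; rewrite ?Hb // Ho addnCA subnKC ?modnDr; last exact/ltnW/o_lt.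
by rewrite modn_small // /l -bE o_lt.
Qed.

Let ord_lt j (i : 'I_(nth 0 ls j)) : flatten_index ls j i < r.
Proof. by rewrite -{1}sumn_ls; apply/flatten_indexP/ltn_ord. Qed.
Let ordb j (i : 'I_(nth 0 ls j)) : 'I_r := Ordinal (ord_lt i).
Let b_ordb j (i : 'I_(nth 0 ls j)) : b (ordb i) = j.
Proof. exact/flatten_indexKl/ltn_ord. Qed.
Let o_ordb j (i : 'I_(nth 0 ls j)) : o (ordb i) = i.
Proof. exact/flatten_indexKr/ltn_ord. Qed.

Let block_im j : block j = [set ordb i | i : 'I_(nth 0 ls j)].
Proof.
apply/setP=> k; rewrite inE; apply/eqP/imsetP => [<-|[i _ ->]].
  exists (Ordinal (o_lt k)) => //.
  by apply: bo_inj; rewrite ?b_ordb ?o_ordb.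
exact: b_ordb.
Qed.

Let ordb_inj j : injective (@ordb j).
Proof.
by move=> i i' /(congr1 o); rewrite !o_ordb => /val_inj.
Qed.

Let card_block j : #|block j| = nth 0 ls j.
Proof. by rewrite block_im card_imset ?card_ord //; apply: ordb_inj. Qed.

Let cycle_prod_block j :
  j < size ls -> cycle_prod g (block j) = (val zeta ^+ us j)%R.
Proof.
move=> j_lt; have l0 := ls_gt0 j_lt; pose k0 := ordb (Ordinal l0).
rewrite /cycle_prod (bigD1 k0) /=; last by rewrite inE b_ordb.
rewrite big1 ?mulr1 => [|k /andP[]].
  by rewrite ffunE o_ordb eqxx b_ordb val_muX.
rewrite inE ffunE => /eqP bk neq; rewrite ifN //; apply: contraNneq neq => ok.
by apply/eqP/bo_inj; rewrite ?b_ordb ?o_ordb.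
Qed.

Let porbits_blocks :
  perm_eq (enum (porbits sg)) [seq block j | j <- iota 0 (size ls)].
Proof.
apply: uniq_perm; first exact: enum_uniq.
  rewrite map_inj_in_uniq ?iota_uniq // => i j; rewrite !mem_iota /= add0n.
  move=> /ls_gt0 i0 _ /setP/(_ (ordb (Ordinal i0))).
  by rewrite !inE b_ordb eqxx => /esym/eqP.
move=> c; rewrite mem_enum; apply/imsetP/mapP => [[k _ ->]|[j]].
  by exists (b k); rewrite ?porbit_sg // mem_iota /= add0n.
rewrite mem_iota /= add0n => /ls_gt0 j0 ->; exists (ordb (Ordinal j0)) => //.
by rewrite porbit_sg b_ordb.
Qed.

Let zetaX_inj (u v : 'I_n) : (val zeta ^+ u == val zeta ^+ v)%R = (u == v).
Proof.
rewrite -!val_muX; apply/eqP/eqP => [/val_inj zE|-> //].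
have n_gt0 : 0 < n by apply: leq_trans (ltn_ord u0).
have oz : n <= #[zeta]%g.
  rewrite orderE -(eqP zeta_gen) cardsT.
  have [w wP] := C_prim_root_exists n_gt0.
  have wmu (i : 'I_n) : is_mu n (w ^+ i)%R.
    by rewrite is_muE // exprAC (prim_expr_order wP) expr1n.
  rewrite -[X in X <= _]card_ord; apply: (@leq_card _ _ (fun i => Mu (wmu i))).
  move=> i j /(congr1 val) /= /eqP; rewrite (eq_prim_root_expr wP).
  by rewrite !modn_small // => /eqP/val_inj.
apply: val_inj; move/eqP: zE; rewrite eq_expg_mod_order.
by rewrite !modn_small ?(leq_trans (ltn_ord _) oz) // => /eqP.
Qed.

Lemma standard_rep_exists_aux : is_standard_rep zeta eta g.
Proof.
split=> [u|].
  have geq_trans : transitive geq by move=> y x z /= yx zy; apply: leq_trans zy yx.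
  have geq_anti : antisymmetric geq by move=> x y /=; rewrite andbC => /anti_leq.
  have geq_total : total geq by move=> x y; apply: leq_total.
  apply: (sorted_eq geq_trans geq_anti); last 1 first.
  - rewrite perm_sym perm_sort perm_sym /=.
    have /(perm_filter (fun c => cycle_prod g c == val zeta ^+ u)%R) := porbits_blocks.
    move/(perm_map (fun c : {set 'I_r} => #|c|)) => /permPr->.
    rewrite filter_map -map_comp (eq_map (_ : _ =1 nth 0 ls)); last first.
      by move=> j /=; rewrite card_block.
    rewrite (@eq_in_filter _ _ (fun j => us j == u)); last first.
      move=> j; rewrite mem_iota /= add0n => j_lt.
      by rewrite cycle_prod_block // zetaX_inj.
    rewrite -parts_cyc -[in X in perm_eq X _](mkseq_nth (0, u0) cyc) /mkseq.
    rewrite filter_map -map_comp /ls size_map.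
    rewrite (_ : map _ _ = [seq nth 0 [seq x.1 | x <- cyc] j
               | j <- iota 0 (size cyc) & us j == u]) //.
    apply/eq_in_map=> j; rewrite mem_filter mem_iota /= add0n => /andP[_ j_lt].
    by rewrite (nth_map (0, u0)).
  - by move: etaMP; rewrite inE => /andP[/forallP/(_ u)/andP[]].
  - exact: sort_sorted.
exists ls; split=> // [|j k L lj j_lt /andP[Lk kL]].
  by apply/(nthP 0) => -[j /ls_gt0]; rewrite lt0n => /eqP.
have kL' : k - L < lj by rewrite ltn_subLR.
have kE : k = ordb (Ordinal kL').
  by apply: val_inj; rewrite /= /flatten_index -/L subnKC.
have bk : b k = j by rewrite kE b_ordb.
have ok : o k = k - L by rewrite kE o_ordb -kE.
split.
  rewrite permE /= /flatten_index /l bk ok -/L -/lj.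
  case: ltnP => [ltk|gek].
    rewrite modn_small; first by rewrite addnS subnKC.
    by rewrite -subSn // ltn_subLR // leqW.
  have -> : (k - L).+1 = lj by apply/eqP; rewrite eqn_leq kL' -subSn // leq_subRL ?gek // leqW.
  by rewrite modnn addn0.
rewrite porbit_sg bk cycle_prod_block // ffunE ok bk subn_eq0.
by rewrite [_ == L]eqn_leq Lk andbT; case: ifP; rewrite ?val_muX.
Qed.

End StandardRepExists.

Lemma standard_rep_exists n r (zeta : mu n) (eta : mseq n r) :
    0 < n -> generator [set: mu n] zeta -> eta \in MP n r ->
  exists g, is_standard_rep zeta eta g.
Proof.
case: n => // n in zeta eta * => _ zeta_gen etaMP.
by eexists; apply: (standard_rep_exists_aux ord0).
Qed.

(* Main.v *)
Require Import Defs.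
From mathcomp Require Import all_boot all_order all_algebra.
From mathcomp Require Import all_fingroup all_solvable all_field.

Set Implicit Arguments.
Unset Strict Implicit.
Unset Printing Implicit Defensive.

Import GRing.Theory.

(** Write N for G(de,e,r), the kernel of eps in G(de,1,r).

    The classes of G(de,1,r) are classified by cyclic structures: conjugation
    carries cycles to cycles and preserves their lengths and cycle products
    ([intertwine_structure]), every element has a cyclic structure
    ([structure_exists]), and a bijection between the cycles of two elements
    that respects lengths and cycle products lifts to a conjugating element
    ([conj_of_structure]).  So each class of G(de,1,r) contains exactly one
    standard representative s, of structure eta say, and it remains to see how
    this class splits under N.  Since G(de,1,r) / N embeds through eps in the
    e-th roots of unity, which are the powers of delta = zeta ^ d, and g maps
    to the generator delta, the elements g^i s g^-i and g^j s g^-j are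
    conjugate under N if and only if delta ^ (i - j) is a value of eps on the
    centraliser of s.

    These values form a group of powers of delta, hence consist of the
    delta ^ k with m dividing k, for a divisor m of e.  On the one hand, the
    centraliser contains, for each cycle c of s, the diagonal element equal to
    zeta on c and to 1 elsewhere, and the restriction of s to c; eps takes the
    values delta ^ #|c| and delta ^ u on them, zeta ^ u being the cycle
    product of c.  So m divides all lengths and all exponents u, that is, eta
    lies in [MPdiv m] ([cent_eps_image]).  On the other hand, if eta lies in
    [MPdiv q] for a divisor q of e, then eps takes only values delta ^ k with q
    dividing k on the centraliser ([cent_eps_dvd]), so q divides m.
    Therefore the representatives g^j s g^-j with j < q for some such q are
    those with j < m, and exactly one of them lies in each class of N contained
    in the class of s. *)

(** * Orbits of a permutation *)

(** The points listed before the first return to x are distinct, and x is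
    reached again after as many steps as its cycle has points. *)
Lemma iter_porbit_mod (T : finType) (s : {perm T}) (x : T) (i j : nat) :
  (iter i s x == iter j s x) = (i == j %[mod #|porbit s x|]).
Proof.
set l := #|_|; have l_gt0 : 0 < l by rewrite lt0n card_porbit_neq0.
have iter_mod m : iter m s x = nth x (traject s x l) (m %% l).
  rewrite nth_traject ?ltn_mod // {1}(divn_eq m l) addnC iterD; congr iter.
  by elim: (m %/ l) => // q IHq; rewrite mulSn iterD IHq iter_porbit.
rewrite !iter_mod nth_uniq ?size_traject ?ltn_mod //.
exact: uniq_traject_porbit.
Qed.

Lemma porbitPiter (T : finType) (s : {perm T}) (x y : T) :
  reflect (exists i, y = iter i s x) (y \in porbit s x).
Proof.
by apply: (iffP (porbitP s x y)) => -[i ->]; exists i; rewrite permX.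
Qed.

Lemma porbits_porbit (T : finType) (s : {perm T}) (x : T) :
  porbit s x \in porbits s.
Proof. exact: imset_f. Qed.

Lemma porbit_of_mem (T : finType) (s : {perm T}) (c : {set T}) (x : T) :
  c \in porbits s -> x \in c -> c = porbit s x.
Proof.
by move=> /imsetP[y _ ->]; rewrite porbit_sym -eq_porbit_mem => /eqP.
Qed.

Lemma mem_porbits_perm (T : finType) (s : {perm T}) (c : {set T}) (x : T) :
  c \in porbits s -> (s x \in c) = (x \in c).
Proof.
move=> /imsetP[y _ ->]; rewrite -!eq_porbit_mem.
by rewrite -[s x]/((s ^+ 1)%g x) porbit_perm.
Qed.

Lemma card_porbits_sum (T : finType) (s : {perm T}) :
  \sum_(c in porbits s) #|c| = #|T|.
Proof.
rewrite -sum1_card (partition_big (porbit s) (mem (porbits s))) /=; last first.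
  by move=> x _; apply: porbits_porbit.
apply: eq_bigr => c cP; rewrite -sum1_card; apply: eq_bigl => x.
apply/idP/eqP => [/(porbit_of_mem cP)-> // | <-]; exact: porbit_id.
Qed.

(** [froot s x] serves as a base point chosen uniformly on the cycle of x, so
    that x is determined by its base point and an exponent. *)
Lemma froot_iter (T : finType) (s : {perm T}) (x : T) :
  exists i, x = iter i s (froot s x).
Proof.
exists (findex s (froot s x) x); rewrite iter_findex //.
by rewrite fconnect_sym ?connect_root //; apply: perm_inj.
Qed.

Lemma froot_perm (T : finType) (s : {perm T}) (x : T) :
  froot s (s x) = froot s x.
Proof.
apply/esym/eqP; rewrite root_connect ?fconnect1 //.
exact/fconnect_sym/perm_inj.
Qed.

Lemma porbit_froot (T : finType) (s : {perm T}) (x : T) :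
  porbit s (froot s x) = porbit s x.
Proof.
have [i xE] := froot_iter s x.
by rewrite {2}xE -permX porbit_perm.
Qed.

(** * Intertwiners *)

Lemma mu_mulC n (x y : mu n) : (x * y = y * x)%g.
Proof. by apply: val_inj; rewrite /= mulrC. Qed.

(** The relation h x = y h, rather than y = h x h^-1, treats conjugation and
    centralisers alike.  Evaluating it at a point of the form h (x k) clears
    the inverse permutations from the product of the wreath product. *)
Lemma intertwineP n r (h x y : Gn1 n r) :
  (h * x = y * h)%g <->
  forall k : 'I_r,
    sigma_of h (sigma_of x k) = sigma_of y (sigma_of h k) /\
    (z_of h (sigma_of h (sigma_of x k)) * z_of x (sigma_of x k)
     = z_of y (sigma_of y (sigma_of h k)) * z_of h (sigma_of h k))%g.
Proof.
split=> [E k | H].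
  have sE : sigma_of h (sigma_of x k) = sigma_of y (sigma_of h k).
    by have /permP/(_ k) := congr1 (@sigma_of n r) E; rewrite !permM.
  split=> //.
  have /ffunP/(_ (sigma_of h (sigma_of x k))) := congr1 (@z_of n r) E.
  by rewrite !ffunE permK sE permK.
have sE : (sigma_of x * sigma_of h = sigma_of h * sigma_of y)%g.
  by apply/permP=> k; rewrite !permM; case: (H k).
congr MkGn1 => //; apply/ffunP=> k; rewrite !ffunE.
pose k' := ((sigma_of x)^-1 ((sigma_of h)^-1 k))%g.
have kE : k = sigma_of h (sigma_of x k') by rewrite !permKV.
move: k' kE => k' ->; have [skE zkE] := H k'.
by rewrite permK zkE skE permK.
Qed.

Lemma intertwine_cycle n r (h x y : Gn1 n r) (k : 'I_r) :
  (h * x = y * h)%g ->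
  porbit (sigma_of y) (sigma_of h k) = sigma_of h @: porbit (sigma_of x) k.
Proof.
move=> /intertwineP H.
have E i : iter i (sigma_of y) (sigma_of h k)
           = sigma_of h (iter i (sigma_of x) k).
  by elim: i => //= i ->; case: (H (iter i (sigma_of x) k)).
apply/setP=> m; apply/porbitPiter/imsetP => [[i ->]|[m' /porbitPiter[i ->] ->]].
  by exists (iter i (sigma_of x) k) => //; apply/porbitPiter; exists i.
by exists i.
Qed.

Lemma intertwine_porbits n r (h x y : Gn1 n r) :
  (h * x = y * h)%g ->
  perm_eq (enum (porbits (sigma_of y)))
          [seq sigma_of h @: c | c : {set 'I_r} <- enum (porbits (sigma_of x))].
Proof.
move=> E; apply: uniq_perm; first exact: enum_uniq.
  rewrite map_inj_uniq ?enum_uniq //; exact/imset_inj/perm_inj.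
move=> c; rewrite mem_enum; apply/imsetP/mapP => [[k _ ->]|[c']].
  rewrite -[k](permKV (sigma_of h)) (intertwine_cycle _ E).
  by eexists; last reflexivity; rewrite mem_enum porbits_porbit.
rewrite mem_enum => /imsetP[k _ ->] ->.
by exists (sigma_of h k); rewrite // (intertwine_cycle _ E).
Qed.

(** The entries of y on the image of a cycle c are those of x on c, up to
    factors that form a quotient of the entries of h at a point and at its
    successor in the cycle; these telescope around the cycle. *)
Lemma intertwine_cycle_prod n r (h x y : Gn1 n r) (c : {set 'I_r}) :
  (h * x = y * h)%g -> c \in porbits (sigma_of x) ->
  cycle_prod y (sigma_of h @: c) = cycle_prod x c.
Proof.
move=> /intertwineP H cP.
pose W := (\prod_(k in c) val (z_of h (sigma_of h k)))%R.
have shift (F : 'I_r -> algC) :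
    (\prod_(k in c) F k = \prod_(k in c) F (sigma_of x k))%R.
  rewrite (reindex_inj (@perm_inj _ (sigma_of x))) /=.
  by apply: eq_bigl => k; rewrite mem_porbits_perm.
have W0 : W != 0%R.
  apply/prodf_neq0 => k _; apply/eqP => w0.
  have := valP (z_of h (sigma_of h k)).
  by rewrite /= /is_mu w0 expr0n eq_sym oner_eq0.
apply: (mulIf W0); rewrite {1}/W /cycle_prod big_imset /=; last first.
  by move=> ? ? _ _; apply: perm_inj.
(* Both products are moved one step along the cycle, and so is the auxiliary
   factor on the right only: the identity then holds factor by factor. *)
rewrite (shift (fun k => val (z_of y _))) (shift (fun k => val (z_of x _))).
have -> : (W = \prod_(k in c) val (z_of h (sigma_of h (sigma_of x k))))%R.
  exact: (shift (fun k => val (z_of h (sigma_of h k)))).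
rewrite -!big_split /=; apply: eq_bigr => k _; have [sE zE] := H k.
by rewrite -!val_muM sE -zE sE mu_mulC.
Qed.

(** * Cyclic structures *)

(** The powers of a generator include a primitive n-th root of unity, whose
    order cannot exceed that of the generator. *)
Lemma generator_prim_root n (zeta : mu n) :
  0 < n -> generator [set: mu n] zeta -> (n.-primitive_root (val zeta))%R.
Proof.
move=> n_gt0 zeta_gen; have [w wP] := C_prim_root_exists n_gt0.
have w_mu : is_mu n w by rewrite is_muE // (prim_expr_order wP).
have /cycleP[i wE] : Mu w_mu \in <[zeta]>%g by rewrite -(eqP zeta_gen) inE.
have zetan : (val zeta ^+ n = 1)%R.
  by apply/eqP; rewrite -is_muE //; apply: valP.
have [m mP m_dvd] := prim_order_exists n_gt0 zetan.
suff n_dvd : n %| m.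
  have /eqP mn : m == n by rewrite eqn_dvd m_dvd.
  by move: (val zeta) mP; rewrite mn.
rewrite (prim_order_dvd wP) -[w]/(val (Mu w_mu)) wE val_muX exprAC.
by rewrite (prim_expr_order mP) expr1n.
Qed.

Lemma cycle_prod_zeta n r (zeta : mu n) (g : Gn1 n r) (c : {set 'I_r}) :
  (n.-primitive_root (val zeta))%R ->
  exists u : 'I_n, cycle_prod g c = (val zeta ^+ u)%R.
Proof.
move=> zP; have cn1 : (cycle_prod g c ^+ n = 1)%R.
  rewrite /cycle_prod -prodrXl big1 // => k _.
  by apply/eqP; rewrite -is_muE ?(prim_order_gt0 zP) //; apply: valP.
by have [u ->] := prim_rootP zP cn1; exists u.
Qed.

(** The list that [has_cyclic_structure] sorts. *)
Definition cycle_sizes n r (zeta : mu n) (g : Gn1 n r) (u : 'I_n) : seq nat :=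
  [seq #|c| | c : {set 'I_r} <- enum (porbits (sigma_of g))
            & cycle_prod g c == (val zeta ^+ u)%R].

Lemma perm_sort_geq (s1 s2 : seq nat) :
  reflect (sort geq s1 = sort geq s2) (perm_eq s1 s2).
Proof.
apply: perm_sortP => [x y|y x z /= yx zy|x y /=]; first exact: leq_total.
  exact: leq_trans zy yx.
by rewrite andbC => /anti_leq.
Qed.

Lemma intertwine_structure n r (zeta : mu n) (h x y : Gn1 n r) eta :
  (h * x = y * h)%g ->
  has_cyclic_structure zeta x eta -> has_cyclic_structure zeta y eta.
Proof.
move=> E Hx u; rewrite Hx; apply/perm_sort_geq.
have Ep := intertwine_porbits E.
rewrite perm_sym (perm_trans (perm_map _ (perm_filter _ Ep))) //.
rewrite filter_map -map_comp.
rewrite (eq_map (_ : _ =1 fun c : {set 'I_r} => #|c|)); last first.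
  by move=> c /=; rewrite card_imset //; apply: perm_inj.
rewrite (@eq_in_filter _ _ (fun c => cycle_prod x c == val zeta ^+ u)%R) //.
by move=> c; rewrite mem_enum => cP /=; rewrite (intertwine_cycle_prod E).
Qed.

Lemma structure_inj n r (zeta : mu n) (g : Gn1 n r) (eta eta' : mseq n r) :
  has_cyclic_structure zeta g eta -> has_cyclic_structure zeta g eta' ->
  eta = eta'.
Proof.
move=> H H'; apply/ffunP=> u; apply: val_inj.
by apply: (inj_map val_inj); rewrite -[LHS]/(parts eta u) H -H'.
Qed.

(** Collecting the cycle lengths by cycle product gives a multipartition of r
    since the cycles partition the r points, and since each cycle product is a
    power zeta ^ u for exactly one u < n. *)
Lemma structure_exists n r (zeta : mu n) (g : Gn1 n r) :
  (n.-primitive_root (val zeta))%R ->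
  exists2 eta, eta \in MP n r & has_cyclic_structure zeta g eta.
Proof.
move=> zP; pose S u := sort geq (cycle_sizes zeta g u).
have memS u p : p \in S u -> exists2 c, c \in porbits (sigma_of g) &
    cycle_prod g c = (val zeta ^+ u)%R /\ p = #|c|.
  rewrite mem_sort => /mapP[c]; rewrite mem_filter mem_enum.
  by move=> /andP[/eqP cE cP] ->; exists c.
have size_S u : size [seq inord p : 'I_r.+1 | p <- S u] <= r.
  rewrite size_map size_sort size_map size_filter.
  apply: leq_trans (count_size _ _) _; rewrite -cardE.
  by apply: leq_trans (leq_imset_card _ _) _; rewrite card_ord.
pose eta : mseq n r := [ffun u => Bseq (size_S u)].
have partsE u : parts eta u = S u.
  rewrite /parts ffunE /= -map_comp map_id_in // => p /memS[c _ [_ ->]] /=.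
  by rewrite inordK // ltnS -[leqRHS]card_ord max_card.
exists eta => //; rewrite inE; apply/andP; split.
  apply/forallP=> u; rewrite partsE; apply/andP; split.
    by apply: sort_sorted => p q; apply: leq_total.
  apply/negP=> /memS[c /imsetP[k _ ->] [_ /esym/eqP]].
  by rewrite (negbTE (card_porbit_neq0 _ _)).
rewrite -[X in _ == X]card_ord -(card_porbits_sum (sigma_of g)); apply/eqP.
rewrite (eq_bigr (fun u : 'I_n => \sum_(c in porbits (sigma_of g)
   | cycle_prod g c == (val zeta ^+ u)%R) #|c|)); last first.
  move=> u _; rewrite partsE sumnE (perm_big _ (permEl (perm_sort _ _))) /=.
  by rewrite big_map big_filter big_enum_cond.
rewrite (exchange_big_dep (mem (porbits (sigma_of g)))) /=; last first.
  by move=> u c _ /andP[].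
apply: eq_bigr => c cP.
have [u cE] := cycle_prod_zeta g c zP.
rewrite (big_pred1 u) // => v; rewrite cP cE (eq_prim_root_expr zP).
by rewrite !modn_small // eq_sym.
Qed.

(** * Elements with the same cyclic structure are conjugate *)

(** Two lists with the same labels, counted with multiplicity, can be matched
    injectively along labels; [x0] only makes [T2] inhabited. *)
Lemma perm_eq_matching (T1 T2 : eqType) (L : eqType) (f1 : T1 -> L)
    (f2 : T2 -> L) (s1 : seq T1) (s2 : seq T2) (x0 : T2) :
  uniq s1 -> uniq s2 -> perm_eq (map f1 s1) (map f2 s2) ->
  exists phi : T1 -> T2,
    [/\ {in s1, forall x, phi x \in s2}, {in s1, forall x, f2 (phi x) = f1 x}
      & {in s1 &, injective phi}].
Proof.
elim: s1 s2 => [|x s1 IHs] s2 /=; first by exists (fun=> x0).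
case/andP=> nx u1 u2 P.
have /mapP[y ys2 fy] : f1 x \in map f2 s2.
  by rewrite -(perm_mem P) mem_head.
have P' : perm_eq (map f1 s1) (map f2 (rem y s2)).
  rewrite -(perm_cons (f1 x)) (perm_trans P) // fy -[_ :: _]/(map f2 (y :: _)).
  exact/perm_map/perm_to_rem.
have [phi [phiS phif phiI]] := IHs _ u1 (rem_uniq y u2) P'.
have phi_ny z : z \in s1 -> phi z \in s2 /\ phi z != y.
  by move=> /phiS; rewrite mem_rem_uniq // inE => /andP[].
exists (fun z => if z == x then y else phi z); split=> [z|z|z w].
- by rewrite inE; case: eqVneq => //= _ /phi_ny[].
- by rewrite inE; case: eqVneq => [->|] //= _ /phif.
rewrite !inE; case: eqVneq => [->|_ /=]; case: eqVneq => [->|_ /=] //.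
- by move=> _ /phi_ny[_ /eqP yN] E; case: yN.
- by move=> /phi_ny[_ /eqP yN] _ E; case: yN.
exact: phiI.
Qed.

Lemma cycle_matching n r (zeta : mu n) (x y : Gn1 n r) eta :
  (n.-primitive_root (val zeta))%R ->
  has_cyclic_structure zeta x eta -> has_cyclic_structure zeta y eta ->
  exists phi : {set 'I_r} -> {set 'I_r},
    [/\ {in porbits (sigma_of x), forall c, phi c \in porbits (sigma_of y)},
        {in porbits (sigma_of x), forall c,
          #|phi c| = #|c| /\ cycle_prod y (phi c) = cycle_prod x c}
      & {in porbits (sigma_of x) &, injective phi}].
Proof.
move=> zP Hx Hy.
pose lab (g : Gn1 n r) (c : {set 'I_r}) := (#|c|, cycle_prod g c).
have lab_count (g : Gn1 n r) (u : 'I_n) l :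
    count_mem (l, (val zeta ^+ u)%R) (map (lab g) (enum (porbits (sigma_of g))))
    = count_mem l (cycle_sizes zeta g u).
  rewrite /cycle_sizes !count_map count_filter; apply: eq_count => c /=.
  by rewrite -pair_eqE.
have labP (g : Gn1 n r) l : l \in map (lab g) (enum (porbits (sigma_of g))) ->
    exists m (u : 'I_n), l = (m, (val zeta ^+ u)%R).
  case/mapP=> c _ ->; have [u cE] := cycle_prod_zeta g c zP.
  by exists #|c|, u; rewrite /lab cE.
have P : perm_eq (map (lab x) (enum (porbits (sigma_of x))))
                 (map (lab y) (enum (porbits (sigma_of y)))).
  apply/allP=> l; rewrite mem_cat => ls.
  have [m [u ->]] : exists m (u : 'I_n), l = (m, (val zeta ^+ u)%R).
    by case/orP: ls => /labP.
  rewrite /= !lab_count; apply/eqP/seq.permP.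
  by apply/perm_sort_geq; rewrite -[LHS]Hx -[RHS]Hy.
have [phi [H1 H2 H3]] := perm_eq_matching set0 (enum_uniq _) (enum_uniq _) P.
exists phi; split=> [c cP | c cP | c c' cP cP'].
- by rewrite -mem_enum H1 ?mem_enum.
- by have := H2 c; rewrite mem_enum => /(_ cP)[].
by apply: H3; rewrite mem_enum.
Qed.

(** The factor at the point a itself is the last one when t is the length of
    the cycle of a.  In the monomial action of g, the coefficient that g^t
    picks up on the basis vector of index a. *)
Definition cycle_partial_prod n r (g : Gn1 n r) (a : 'I_r) (t : nat) : mu n :=
  (\prod_(0 <= s < t) z_of g (iter s.+1 (sigma_of g) a))%g.

Lemma cycle_partial_prodS n r (g : Gn1 n r) a t :
  cycle_partial_prod g a t.+1
  = (cycle_partial_prod g a t * z_of g (iter t.+1 (sigma_of g) a))%g.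
Proof. by rewrite /cycle_partial_prod big_nat_recr. Qed.

Lemma cycle_partial_prod_full n r (g : Gn1 n r) a :
  val (cycle_partial_prod g a #|porbit (sigma_of g) a|)
  = cycle_prod g (porbit (sigma_of g) a).
Proof.
set s := sigma_of g; set l := #|_|.
have -> : porbit s a = porbit s (s a) by rewrite (porbit_perm s 1).
have lE : l = #|porbit s (s a)| by rewrite (porbit_perm s 1).
rewrite /cycle_prod (eq_bigl (mem (traject s (s a) l))); last first.
  by move=> k; rewrite lE /= porbit_traject.
rewrite -big_uniq /=; last by rewrite lE uniq_traject_porbit.
rewrite /cycle_partial_prod (big_morph val (@val_muM n) (val_mu1 n)).
have -> : traject s (s a) l = [seq iter i.+1 s a | i <- index_iota 0 l].
  rewrite /index_iota subn0; apply: (@eq_from_nth _ (s a)).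
    by rewrite size_traject size_map size_iota.
  move=> i; rewrite size_traject => il; rewrite nth_traject //.
  by rewrite (nth_map 0) ?size_iota // nth_iota // add0n iterSr.
by rewrite big_map.
Qed.

(** Each full turn around the cycle contributes the cycle product. *)
Lemma cycle_partial_prod_mod n r (g : Gn1 n r) a t :
  let l := #|porbit (sigma_of g) a| in
  cycle_partial_prod g a t
  = (cycle_partial_prod g a l ^+ (t %/ l) * cycle_partial_prod g a (t %% l))%g.
Proof.
move=> l.
have periodic m : cycle_partial_prod g a (l + m)
    = (cycle_partial_prod g a l * cycle_partial_prod g a m)%g.
  elim: m => [|m IHm].
    by rewrite addn0 [cycle_partial_prod g a 0]big_geq ?mulg1.
  rewrite addnS !cycle_partial_prodS IHm mulgA -addnS addnC iterD.
  by rewrite iter_porbit.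
rewrite {1}(divn_eq t l); elim: (t %/ l) => [|q IHq]; first by rewrite mul1g.
by rewrite mulSn -addnA periodic IHq expgS mulgA.
Qed.

(** Choose base points b in each cycle of x and beta b in the matching cycle of
    y.  The permutation part tau of h sends the t-th iterate of b to the t-th
    iterate of beta b, and the entry of h at the latter point is the quotient
    of the two partial products.  Both depend on t only modulo the length of
    the cycle, as the matched cycles have equal lengths and equal cycle
    products, and then the relation h x = y h holds one step at a time. *)
Lemma conj_of_structure n r (zeta : mu n) (x y : Gn1 n r) eta :
  (n.-primitive_root (val zeta))%R ->
  has_cyclic_structure zeta x eta -> has_cyclic_structure zeta y eta ->
  exists h, (h * x = y * h)%g.
Proof.
move=> zP Hx Hy; have [phi [phiP phiE phiI]] := cycle_matching zP Hx Hy.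
set sx := sigma_of x; set sy := sigma_of y.
have /fin_all_exists[beta betaP] (k : 'I_r) :
    exists b, porbit sy b = phi (porbit sx k).
  have /imsetP[b _ ->] := phiP _ (porbits_porbit sx k); by exists b.
have /fin_all_exists[ix ixP] := froot_iter sx.
have card_beta k : #|porbit sy (beta k)| = #|porbit sx k|.
  by rewrite betaP; case: (phiE _ (porbits_porbit sx k)).
pose tau k := iter (ix k) sy (beta (froot sx k)).
have porbit_tau k : porbit sy (tau k) = phi (porbit sx k).
  by rewrite /tau -permX porbit_perm betaP porbit_froot.
have tau_inj : injective tau.
  move=> k k' E; have rE : froot sx k = froot sx k'.
    have : porbit sx k = porbit sx k'.
      by apply: phiI; rewrite ?porbits_porbit // -!porbit_tau E.
    move/eqP; rewrite eq_porbit_mem => /porbitPiter[i ->].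
    by elim: i => //= i IHi; rewrite froot_perm.
  rewrite (ixP k) (ixP k') rE; apply/eqP; rewrite iter_porbit_mod -card_beta.
  by rewrite -iter_porbit_mod; move/eqP: E; rewrite /tau rE.
pose a k := froot sx k.
have ixS k : ix (sx k) = (ix k).+1 %[mod #|porbit sx (a k)|].
  apply/eqP; rewrite -iter_porbit_mod iterS -ixP -[a k]froot_perm -ixP.
  exact: eqxx.
pose V b t :=
  ((cycle_partial_prod x b t)^-1 * cycle_partial_prod y (beta b) t)%g.
have V_mod b t t' : t = t' %[mod #|porbit sx b|] -> V b t = V b t'.
  move=> E; rewrite /V (cycle_partial_prod_mod x b t).
  rewrite (cycle_partial_prod_mod x b t') (cycle_partial_prod_mod y _ t).
  rewrite (cycle_partial_prod_mod y _ t') card_beta -E.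
  set A := cycle_partial_prod x b _; set B := cycle_partial_prod y _ _.
  have -> : B = A.
    apply: val_inj; rewrite /B -card_beta !cycle_partial_prod_full betaP.
    by case: (phiE _ (porbits_porbit sx b)).
  have V_red q p p' : ((A ^+ q * p)^-1 * (A ^+ q * p') = p^-1 * p')%g.
    by rewrite invMg -mulgA mulKg.
  by rewrite [LHS]V_red [RHS]V_red.
have VS b t : (V b t.+1 * z_of x (iter t.+1 sx b)
               = z_of y (iter t.+1 sy (beta b)) * V b t)%g.
  rewrite /V !cycle_partial_prodS invMg -!mulgA.
  by rewrite [RHS]mu_mulC [LHS]mu_mulC -!mulgA mulgV mulg1.
pose w := [ffun m => let k := (perm tau_inj)^-1%g m in V (a k) (ix k)].
exists (MkGn1 w (perm tau_inj)); apply/intertwineP=> k /=; rewrite -/sx -/sy.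
have tauS : tau (sx k) = sy (tau k).
  rewrite /tau froot_perm -iterS; apply/eqP; rewrite iter_porbit_mod card_beta.
  exact/eqP/ixS.
rewrite !ffunE /= !permK !permE; split=> //.
rewrite /a froot_perm -/(a k) (V_mod _ _ _ (ixS k)).
by have := VS (a k) (ix k); rewrite !iterS -(ixP k).
Qed.

(** * The values of eps on a centraliser *)

Lemma zetaXd_prim_root d e (zeta : mu (d * e)) :
  0 < d -> (d * e).-primitive_root%R (val zeta) ->
  e.-primitive_root%R (val zeta ^+ d)%R.
Proof.
move=> d_gt0 zP; have := dvdn_prim_root zP (dvdn_mull d (dvdnn e)).
have e_gt0 : 0 < e by have := prim_order_gt0 zP; rewrite muln_gt0 d_gt0.
by rewrite mulnK.
Qed.

Lemma eps_expr d e r (h : Gn1 (d * e) r) k :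
  (eps h ^+ k = \prod_i val (z_of h i) ^+ (d * k))%R.
Proof. by rewrite /eps -exprM prodrXl. Qed.

Lemma eps_zetaX d e r (zeta : mu (d * e)) (h : Gn1 (d * e) r) :
  0 < d -> (d * e).-primitive_root%R (val zeta) ->
  exists k, (eps h = (val zeta ^+ d) ^+ k)%R.
Proof.
move=> d_gt0 zP; have de_gt0 := prim_order_gt0 zP.
have eps1 : (eps h ^+ e = 1)%R.
  rewrite eps_expr // big1 // => k _.
  by apply/eqP; rewrite -is_muE //; apply: valP.
by have [k ->] := prim_rootP (zetaXd_prim_root d_gt0 zP) eps1; exists k.
Qed.

(** A diagonal element commutes with g when it is constant on the cycles
    of g. *)
Lemma cent_scalar_on_cycle d e r (zeta : mu (d * e)) (g : Gn1 (d * e) r) c :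
  c \in porbits (sigma_of g) ->
  exists2 h, (h * g = g * h)%g & (eps h = (val zeta ^+ d) ^+ #|c|)%R.
Proof.
move=> cP; exists (MkGn1 [ffun k => if k \in c then zeta else 1%g] 1%g).
  apply/intertwineP=> k /=; rewrite !ffunE !perm1; split=> //.
  by rewrite mem_porbits_perm // mu_mulC.
rewrite /eps exprAC /=; congr (_ ^+ _)%R.
rewrite (eq_bigr (fun k => if k \in c then val zeta else 1%R)); last first.
  by move=> k _; rewrite ffunE; case: ifP.
by rewrite -big_mkcond prodr_const.
Qed.

(** The element is the factor of g that corresponds to the cycle c; distinct
    factors have disjoint supports and commute. *)
Lemma cent_restrict_to_cycle d e r (g : Gn1 (d * e) r) c :
  c \in porbits (sigma_of g) ->
  exists2 h, (h * g = g * h)%g & (eps h = cycle_prod g c ^+ d)%R.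
Proof.
move=> cP; pose f k := if k \in c then sigma_of g k else k.
have fc k : (f k \in c) = (k \in c).
  by rewrite /f; case: ifP => // kc; rewrite mem_porbits_perm.
have f_inj : injective f.
  move=> k k' E; have := fc k'; rewrite -E fc => kc.
  by move: E; rewrite /f kc; case: ifP => // _; apply: perm_inj.
exists (MkGn1 [ffun k => if k \in c then z_of g k else 1%g] (perm f_inj)).
  apply/intertwineP=> k /=; rewrite !ffunE !permE /= !fc !mem_porbits_perm //.
  rewrite /f mem_porbits_perm //; case: ifP => // _.
  by rewrite mul1g mulg1.
rewrite /eps /cycle_prod [in RHS]big_mkcond /=; congr (_ ^+ _)%R.
by apply: eq_bigr => k _; rewrite ffunE; case: ifP.
Qed.

Lemma porbit_parts n r (zeta : mu n) (g : Gn1 n r) eta c (u : 'I_n) :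
  has_cyclic_structure zeta g eta -> c \in porbits (sigma_of g) ->
  cycle_prod g c = (val zeta ^+ u)%R -> #|c| \in parts eta u.
Proof.
move=> H cP cE; rewrite H mem_sort; apply/mapP; exists c => //.
by rewrite mem_filter mem_enum cP cE eqxx.
Qed.

Lemma parts_porbit n r (zeta : mu n) (g : Gn1 n r) eta (u : 'I_n) p :
  has_cyclic_structure zeta g eta -> p \in parts eta u ->
  exists c, [/\ c \in porbits (sigma_of g),
                cycle_prod g c = (val zeta ^+ u)%R & p = #|c|].
Proof.
move=> H; rewrite H mem_sort => /mapP[c]; rewrite mem_filter mem_enum.
by move=> /andP[/eqP cE cP] ->; exists c.
Qed.

Lemma MPdiv_porbit n r q (zeta : mu n) (g : Gn1 n r) eta c :
  (n.-primitive_root (val zeta))%R ->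
  has_cyclic_structure zeta g eta -> eta \in MPdiv n r q ->
  c \in porbits (sigma_of g) ->
  q %| #|c| /\ exists2 u, q %| u & (cycle_prod g c = val zeta ^+ u)%R.
Proof.
move=> zP H; rewrite inE => /and3P[_ /forallP etaU /forallP etaP] cP.
have [u cE] := cycle_prod_zeta g c zP.
have pc := porbit_parts H cP cE; split; first exact: (allP (etaP u)).
exists u => //; have := etaU u; case/orP=> // /eqP p0.
by rewrite p0 in pc.
Qed.

(** A character that is trivial on the cycle products of a standard
    representative is therefore trivial on all its entries. *)
Lemma standard_rep_z n r (zeta : mu n) eta (g : Gn1 n r) k :
  is_standard_rep zeta eta g ->
  val (z_of g k) = 1%R
  \/ val (z_of g k) = cycle_prod g (porbit (sigma_of g) k).
Proof.
move=> [_ [ls [_ lsr H]]].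
have k_lt : k < sumn ls by rewrite lsr.
have j_lt := reshape_indexP k_lt; have o_lt := reshape_offsetP k_lt.
have kE := reshape_indexK ls k.
case: (H _ k j_lt) => [|_ ->]; last by case: ifP; [right | left].
by rewrite -{2 3}kE leq_addr ltn_add2l.
Qed.

(** Put e = f q and let chi be the character a |-> a ^ (d f) of the group of
    de-th roots of unity, with values in the q-th roots of unity.  As q divides
    all exponents of the cycle products, chi is trivial on all entries of s.
    Applying chi to h s = s h shows that the chi-values of the entries of h
    are constant on the cycles of s; as q divides the cycle lengths, their
    product is 1.  That product is eps h ^ f, so e divides k f. *)
Lemma cent_eps_dvd d e r q (zeta : mu (d * e)) eta (s h : Gn1 (d * e) r) k :
  0 < d -> (d * e).-primitive_root%R (val zeta) -> q %| e ->
  is_standard_rep zeta eta s -> eta \in MPdiv (d * e) r q ->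
  (h * s = s * h)%g -> (eps h = (val zeta ^+ d) ^+ k)%R -> q %| k.
Proof.
move=> d_gt0 zP /dvdnP[f eE] sP etaq /intertwineP H hk.
have de_gt0 := prim_order_gt0 zP.
have e_gt0 : 0 < e by move: de_gt0; rewrite muln_gt0 d_gt0.
have f_gt0 : 0 < f by move: e_gt0; rewrite eE muln_gt0 => /andP[].
pose chi (a : mu (d * e)) := (val a ^+ (d * f))%R.
have chiM a b : (chi (a * b)%g = chi a * chi b)%R by rewrite /chi -exprMn.
have zetaq u : q %| u -> ((val zeta ^+ u) ^+ (d * f) = 1)%R.
  case/dvdnP=> v ->; apply/eqP; rewrite -exprM -(prim_order_dvd zP) eE.
  by rewrite -mulnA [q * _]mulnC -mulnA dvdn_mull.
have chiX a : (chi a ^+ q = 1)%R.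
  rewrite /chi -exprM -mulnA -eE; apply/eqP; rewrite -is_muE //; exact: valP.
have sH := sP.1.
have chi_s m : chi (z_of s m) = 1%R.
  rewrite /chi; case: (standard_rep_z m sP) => ->; first by rewrite expr1n.
  have [_ [u qu ->]] := MPdiv_porbit zP sH etaq (porbits_porbit _ m).
  exact: zetaq.
have chi_h m : chi (z_of h (sigma_of s m)) = chi (z_of h m).
  have [sE zE] := H ((sigma_of h)^-1 m)%g; move/(congr1 chi): zE.
  by rewrite !chiM !chi_s mulr1 mul1r sE permKV.
have chi_iter i m : chi (z_of h (iter i (sigma_of s) m)) = chi (z_of h m).
  by elim: i => //= i IHi; rewrite chi_h.
have prod1 : (\prod_m chi (z_of h m) = 1)%R.
  rewrite (partition_big (porbit (sigma_of s)) (mem (porbits (sigma_of s)))) /=;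
    last by move=> m _; apply: porbits_porbit.
  apply: big1 => c cP; have [m _ cE] := imsetP cP.
  rewrite (eq_bigr (fun=> chi (z_of h m))) => [|m' /eqP mc]; last first.
    have : m' \in porbit (sigma_of s) m by rewrite -cE -mc porbit_id.
    by case/porbitPiter=> i ->.
  rewrite (eq_bigl (mem c)) => [|m']; last first.
    apply/eqP/idP => [<-|/(porbit_of_mem cP) //]; exact: porbit_id.
  have [/dvdnP[l cl] _] := MPdiv_porbit zP sH etaq cP.
  by rewrite prodr_const cl [(l * q)%N]mulnC exprM chiX expr1n.
have : (eps h ^+ f = 1)%R by rewrite eps_expr.
rewrite hk -exprM => /eqP.
rewrite -(prim_order_dvd (zetaXd_prim_root d_gt0 zP)) eE mulnC.
by rewrite dvdn_pmul2r.
Qed.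

Lemma eps1 d e r : eps (1%g : Gn1 (d * e) r) = 1%R.
Proof. by rewrite /eps big1 ?expr1n // => k _; rewrite ffunE. Qed.

Lemma epsX d e r (h : Gn1 (d * e) r) k : (eps (h ^+ k)%g = eps h ^+ k)%R.
Proof.
elim: k => [|k IHk]; first by rewrite expg0 eps1.
by rewrite expgS exprS epsM IHk.
Qed.

Lemma eps_neq0 d e r (h : Gn1 (d * e) r) : eps h != 0%R.
Proof.
apply/eqP=> h0; have := epsM h h^-1%g; rewrite mulgV eps1 h0 mul0r.
by move/eqP; rewrite oner_eq0.
Qed.

Lemma epsV d e r (h : Gn1 (d * e) r) : (eps h^-1%g = (eps h)^-1)%R.
Proof.
by apply: (mulfI (eps_neq0 h)); rewrite -epsM mulgV eps1 mulfV ?eps_neq0.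
Qed.

(** The exponents k such that delta ^ k is a value of eps on the centraliser
    of s are closed under remainders, so they are the multiples of the least
    positive one, m.  The two families of centralising elements attached to
    the cycles force m to divide all parts of eta and the indices of its
    nonempty components. *)
Lemma cent_eps_image d e r (zeta : mu (d * e)) (s : Gn1 (d * e) r) eta :
  0 < d -> (d * e).-primitive_root%R (val zeta) ->
  eta \in MP (d * e) r -> has_cyclic_structure zeta s eta ->
  exists m, [/\ 0 < m, m %| e, eta \in MPdiv (d * e) r m
    & forall k, m %| k ->
        exists2 h, (h * s = s * h)%g & (eps h = (val zeta ^+ d) ^+ k)%R].
Proof.
move=> d_gt0 zP etaMP H; have deltaP := zetaXd_prim_root d_gt0 zP.
set delta := (val zeta ^+ d)%R in deltaP *.
pose K k := [exists h, (h * s == s * h)%g && (eps h == delta ^+ k)%R].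
have KP k : reflect (exists2 h, (h * s = s * h)%g & (eps h = delta ^+ k)%R)
                    (K k).
  apply: (iffP existsP) => [[h /andP[/eqP hs /eqP hk]]|[h hs hk]].
    by exists h.
  by exists h; rewrite hs hk !eqxx.
have Ke : K e.
  apply/KP; exists 1%g; first by rewrite mulg1 mul1g.
  by rewrite eps1 (prim_expr_order deltaP).
have [|m /andP[m_gt0 Km] m_min] := @ex_minnP (fun k => (0 < k) && K k).
  by exists e; rewrite Ke (prim_order_gt0 deltaP).
have K_dvd k : K k -> m %| k.
  move=> /KP[h hs hk]; have /KP[hm hms hmk] := Km.
  have Kmod : K (k %% m).
    apply/KP; exists (hm ^- (k %/ m) * h)%g.
      apply/commute_sym/commuteM/commute_sym => //.
      exact/commuteV/commuteX/commute_sym.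
    rewrite epsM epsV epsX hmk hk {2}(divn_eq k m) exprD mulnC exprM mulKf //.
    by rewrite -hmk expf_neq0 ?eps_neq0.
  rewrite /dvdn eqn0Ngt; apply/negP=> mod_gt0.
  have := m_min _ (introT andP (conj mod_gt0 Kmod)).
  by rewrite leqNgt ltn_mod m_gt0.
exists m; split=> // [||k /dvdnP[l ->]].
- exact: K_dvd.
- have dvdc c : c \in porbits (sigma_of s) -> m %| #|c|.
    by move=> cP; apply/K_dvd/KP/(cent_scalar_on_cycle zeta cP).
  rewrite inE etaMP /=; apply/andP; split; apply/forallP=> u.
    case E: (parts eta u) => [|p t] /=; first by rewrite orbT.
    have [|c [cP cE _]] := @parts_porbit _ _ zeta s eta u p H.
      by rewrite E mem_head.
    rewrite K_dvd //; apply/KP; have [h hs hE] := cent_restrict_to_cycle cP.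
    by exists h; rewrite // hE cE exprAC.
  by apply/allP=> p /(parts_porbit H)[c [cP _ ->]]; apply: dvdc.
have /KP[h hs hk] := Km; exists (h ^+ l)%g.
  exact/commute_sym/commuteX/commute_sym.
by rewrite epsX hk mulnC exprM.
Qed.

(** * Conjugacy classes of G(de,e,r) *)

Lemma mem_bigcup_seq (I : eqType) (T : finType) (s : seq I) (F : I -> {set T})
    x :
  reflect (exists2 i, i \in s & x \in F i) (x \in \bigcup_(i <- s) F i).
Proof.
suff -> : x \in \bigcup_(i <- s) F i = has (fun i => x \in F i) s.
  exact: hasP.
by elim: s => [|i s IHs]; rewrite ?big_nil ?big_cons /= ?inE ?IHs.
Qed.

(** Conjugation by n carries one representative to the other, so
    h = g^-j' n g^j intertwines the standard elements: their structures agree,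
    and h centralises the common standard element.  As eps n = 1, the value of
    eps on h is delta ^ (j - j'), hence j and j' agree modulo the
    divisor m of e provided by [cent_eps_image]; both are smaller than m
    because q and q' divide m. *)
Lemma rep_conj_inj d e r (zeta : mu (d * e)) (g n : Gn1 (d * e) r)
    (std : mseq (d * e) r -> Gn1 (d * e) r) q q' eta eta' j j' :
  0 < d -> (d * e).-primitive_root%R (val zeta) ->
  (eps g = val zeta ^+ d)%R ->
  (forall eta, eta \in MP (d * e) r -> is_standard_rep zeta eta (std eta)) ->
  q %| e -> q' %| e ->
  eta \in MPdiv (d * e) r q -> eta' \in MPdiv (d * e) r q' ->
  j < q -> j' < q' -> n \in Gder d e r ->
  (g ^+ j * std eta * g ^- j = (g ^+ j' * std eta' * g ^- j') ^ n)%g ->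
  eta = eta' /\ j = j'.
Proof.
move=> d_gt0 zP g_eps stdP qe qe' etaq etaq' jq jq' nN E.
have etaMP : eta \in MP (d * e) r by move: etaq; rewrite inE => /andP[].
have etaMP' : eta' \in MP (d * e) r by move: etaq'; rewrite inE => /andP[].
have deltaP := zetaXd_prim_root d_gt0 zP.
pose h := (g ^- j' * n * g ^+ j)%g.
have hs : (h * std eta = std eta' * h)%g.
  have -> : std eta' = (g ^- j' * (g ^+ j' * std eta' * g ^- j') * g ^+ j')%g.
    by rewrite !mulgA mulVg mul1g mulgKV.
  have -> : std eta = (g ^- j * (g ^+ j * std eta * g ^- j) * g ^+ j)%g.
    by rewrite !mulgA mulVg mul1g mulgKV.
  by rewrite E /h conjgE !mulgA !(mulgK, mulgKV).
have etaE : eta = eta'.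
  apply: (structure_inj (g := std eta') _ (stdP _ etaMP').1).
  exact: intertwine_structure hs (stdP _ etaMP).1.
split=> //; subst eta'; set delta := (val zeta ^+ d)%R in g_eps deltaP.
have eps_g i : eps (g ^+ i)%g = (delta ^+ i)%R by rewrite epsX g_eps.
have e_gt0 := prim_order_gt0 deltaP.
(* The exponent j' (e - 1) stands for - j' modulo e. *)
have hk : eps h = (delta ^+ (j + j' * e.-1))%R.
  have /eqP nE : eps n == 1%R by rewrite inE in nN.
  rewrite /h !epsM epsV !eps_g nE mulr1 mulrC exprD; congr (_ * _)%R.
  have d0 : (delta ^+ j' != 0)%R by rewrite -eps_g eps_neq0.
  apply: (mulfI d0); rewrite mulfV // -exprD -mulnS prednK // mulnC exprM.
  by rewrite (prim_expr_order deltaP) expr1n.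
have [m [m_gt0 me etam mK]] := cent_eps_image d_gt0 zP etaMP (stdP _ etaMP).1.
have m_max p : p %| e -> eta \in MPdiv (d * e) r p -> p %| m.
  move=> pe etap; have [c cs cm] := mK m (dvdnn m).
  exact: cent_eps_dvd d_gt0 zP pe (stdP _ etaMP) etap cs cm.
have jm : j < m by apply: leq_trans jq (dvdn_leq m_gt0 (m_max _ qe etaq)).
have jm' : j' < m by apply: leq_trans jq' (dvdn_leq m_gt0 (m_max _ qe' etaq')).
have m_dvd := cent_eps_dvd d_gt0 zP me (stdP _ etaMP) etam hs hk.
have e_mod : (j' * e) %% m = 0 by apply/eqP; apply: dvdn_mull.
rewrite -(modn_small jm) -(modn_small jm').
transitivity ((j + j' * e) %% m); first by rewrite -modnDmr e_mod addn0.
rewrite -(prednK e_gt0) mulnS addnCA -modnDmr.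
by rewrite (eqP m_dvd) addn0.
Qed.

(** An element h that conjugates the standard element to x has
    eps h = delta ^ i for some i.  Multiplying h on the right by a centralising
    element on which eps is a power of delta ^ -m lowers i to its remainder j
    modulo m; a further factor g^-j puts the conjugating element in the kernel
    of eps, and g^j s g^-j takes the place of s. *)
Lemma rep_conj_exists d e r (zeta : mu (d * e)) (g x : Gn1 (d * e) r)
    (std : mseq (d * e) r -> Gn1 (d * e) r) :
  0 < d -> (d * e).-primitive_root%R (val zeta) ->
  (eps g = val zeta ^+ d)%R ->
  (forall eta, eta \in MP (d * e) r -> is_standard_rep zeta eta (std eta)) ->
  exists q eta j n,
    [/\ q %| e, eta \in MPdiv (d * e) r q, j < q, n \in Gder d e r
      & x = ((g ^+ j * std eta * g ^- j) ^ n)%g].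
Proof.
move=> d_gt0 zP g_eps stdP.
have [eta etaMP Hx] := structure_exists x zP.
have [h hx] := conj_of_structure zP (stdP _ etaMP).1 Hx.
have [m [m_gt0 me etam mK]] := cent_eps_image d_gt0 zP etaMP (stdP _ etaMP).1.
have [i hi] := eps_zetaX h d_gt0 zP.
have [c cs ci] := mK _ (dvdn_mull (i %/ m) (dvdnn m)).
exists m, eta, (i %% m), (g ^+ (i %% m) * c * h^-1)%g; split=> //.
- by rewrite ltn_mod.
- rewrite inE !epsM epsX epsV g_eps ci hi -exprD addnC -divn_eq mulfV //.
  by rewrite -hi eps_neq0.
have -> : x = (h * std eta * h^-1)%g by rewrite hx mulgK.
rewrite conjgE !invMg invgK !mulgA !(mulgK, mulgKV).
by rewrite -!mulgA (mulgA (std eta)) -cs !mulgA mulgKV.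
Qed.

Theorem theorem3p13 (d e r : nat) (zeta : mu (d * e)) (g : Gn1 (d * e) r)
    (std : mseq (d * e) r -> Gn1 (d * e) r)
    (d_gt0 : 0 < d) (e_gt0 : 0 < e) (r_gt0 : 0 < r)
    (zeta_gen : generator [set: mu (d * e)] zeta)
    (e_dvd_r : e %| r)
    (g_order : #[g]%g = e)
    (g_compl : (Gder d e r ><| <[g]> = [set: Gn1 (d * e) r])%g)
    (g_eps : eps g = (val zeta ^+ d)%R)
    (stdP : forall eta : mseq (d * e) r, eta \in MP (d * e) r ->
              is_standard_rep zeta eta (std eta)) :
  let rep (eta : mseq (d * e) r) (j : nat) := (g ^+ j * std eta * g ^- j)%g in
  is_transversal
    (Gder d e r :&:
      \bigcup_(q <- divisors e) [set rep eta j
                                    | eta : mseq (d * e) r in MPdiv (d * e) r q,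
                                      j : 'I_q])
    (classes (Gder d e r)) (Gder d e r)
  /\
  (forall (q q' : nat) (eta eta' : mseq (d * e) r) (j j' : nat),
     q %| e -> q' %| e ->
     eta \in MPdiv (d * e) r q -> eta' \in MPdiv (d * e) r q' ->
     j < q -> j' < q' ->
     rep eta j = rep eta' j' -> eta = eta' /\ j = j').
Proof.
move=> rep; have de_gt0 : 0 < d * e by rewrite muln_gt0 d_gt0.
have zP := generator_prim_root de_gt0 zeta_gen.
have rep_inj q q' eta eta' j j' n :
    q %| e -> q' %| e -> eta \in MPdiv (d * e) r q ->
    eta' \in MPdiv (d * e) r q' -> j < q -> j' < q' -> n \in Gder d e r ->
    rep eta j = (rep eta' j' ^ n)%g -> eta = eta' /\ j = j'.
  exact: (rep_conj_inj d_gt0 zP g_eps stdP).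
split; last first.
  move=> q q' eta eta' j j' qe qe' etaq etaq' jq jq' E.
  by apply: (rep_inj q q' eta eta' j j' 1%g) => //; rewrite ?group1 ?conjg1.
set X := Gder d e r :&: _.
have XP x : reflect (x \in Gder d e r /\ exists q eta j,
    [/\ q %| e, eta \in MPdiv (d * e) r q, j < q & x = rep eta j]) (x \in X).
  rewrite /X in_setI; apply: (iffP andP) => -[xN].
    case/mem_bigcup_seq=> q; rewrite -dvdn_divisors // => qe.
    case/imset2P=> eta j etaq _ xE; split=> //.
    by exists q, eta, (nat_of_ord j).
  move=> [q [eta [j [qe etaq jq xE]]]]; split=> //.
  apply/mem_bigcup_seq; exists q; first by rewrite -dvdn_divisors.
  by rewrite xE; apply/imset2P; exists eta (Ordinal jq).
rewrite /is_transversal classes_partition subsetIl /=.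
apply/forall_inP=> B /imsetP[x xN ->]; apply/cards1P.
have [q [eta [j [n [qe etaq jq nN xE]]]]] :=
  rep_conj_exists x d_gt0 zP g_eps stdP.
have repX : rep eta j \in (x ^: Gder d e r)%g.
  apply/imsetP; exists n^-1%g; first by rewrite groupV.
  by rewrite xE conjgK.
exists (rep eta j); apply/setP=> y; rewrite in_setI in_set1.
apply/idP/eqP=> [|->].
  case/andP=> /XP[_ [q' [eta' [j' [qe' etaq' jq' ->]]]]] yB.
  have /imsetP[m mN yE] : rep eta' j' \in (rep eta j ^: Gder d e r)%g.
    by rewrite (class_eqP repX).
  by case: (rep_inj _ _ _ _ _ _ _ qe' qe etaq' etaq jq' jq mN yE) => -> ->.
rewrite repX andbT; apply/XP; split; last by exists q, eta, j.
by apply: subsetP repX; apply: class_subG.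
Qed.
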